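(* Let $a,b$ be real numbers with $1<a<b$. Then $$\pi=\frac{2b^4}{F_D^{(3)}\!\left(\tfrac32;\tfrac12,\tfrac12,\tfrac12;2\,\Big|\,\dfrac{a^2}{b^2},\dfrac1{a^2b^2},\dfrac1{b^4}\right)}\left(\frac1{b^2-1}\,K\!\left(\frac{b(a^2-1)}{a(b^2-1)}\right)-\frac1{b^2+1}\,K\!\left(\frac{b(a^2+1)}{a(b^2+1)}\right)\right).$$
   Context: $K(k)=\int_0^1\frac{dx}{\sqrt{(1-x^2)(1-k^2x^2)}}$ is the complete elliptic integral of the first kind, as a function of the modulus $k$. The Lauricella function of $n$ variables is $F_D^{(n)}(\alpha;\beta_1,\dots,\beta_n;\gamma\,|\,x_1,\dots,x_n)=\sum_{m_1,\dots,m_n\ge0}\frac{(\alpha)_{m_1+\cdots+m_n}(\beta_1)_{m_1}\cdots(\beta_n)_{m_n}}{(\gamma)_{m_1+\cdots+m_n}\,m_1!\cdots m_n!}x_1^{m_1}\cdots x_n^{m_n}$ for $|x_j|<1$, with $(x)_k$ the Pochhammer symbol. For $\operatorname{Re}\gamma>\operatorname{Re}\alpha>0$ it equals, and outside the region of convergence is defined by analytic continuation through, $\frac{\Gamma(\gamma)}{\Gamma(\alpha)\Gamma(\gamma-\alpha)}\int_0^1\frac{u^{\alpha-1}(1-u)^{\gamma-\alpha-1}}{(1-x_1u)^{\beta_1}\cdots(1-x_nu)^{\beta_n}}\,du$ (principal branches, $x_j\notin[1,\infty)$). *)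

(* Defs.v *)
From HB Require Import structures.
From mathcomp Require Export all_boot all_order all_algebra.
From mathcomp Require Export all_classical all_reals all_analysis.

Set Implicit Arguments.
Unset Strict Implicit.
Unset Printing Implicit Defensive.

Export Order.TTheory GRing.Theory Num.Theory.
Export numFieldNormedType.Exports.

Local Open Scope classical_set_scope.
Local Open Scope ring_scope.

Definition pochhammer (F : numFieldType) (x : F) (k : nat) : F :=
  \prod_(i < k) (x + i%:R).

(* Multi-indices (m_1, ..., m_n) with entries below N are the finite functions
   from 'I_n to 'I_N. *)
Definition lauricellaD_partial (F : numFieldType) (n : nat)
    (alpha : F) (beta : n.-tuple F) (gamma : F) (x : n.-tuple F) (N : nat) : F :=
  \sum_(m : {ffun 'I_n -> 'I_N})
    (pochhammer alpha (\sum_j m j)%N * \prod_j pochhammer (tnth beta j) (m j))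
    / (pochhammer gamma (\sum_j m j)%N * \prod_j ((m j)`!)%:R)
    * \prod_j tnth x j ^+ m j.

(* The n-fold series is summed over growing cubes; for |x_j| < 1 it converges
   absolutely, so the order of summation is immaterial. Only that region is
   covered: the analytic continuation beyond it is not part of the definition. *)
Definition lauricellaD (F : numFieldType) (n : nat)
    (alpha : F) (beta : n.-tuple F) (gamma : F) (x : n.-tuple F) : F :=
  limn (lauricellaD_partial alpha beta gamma x).

(* The argument k is the modulus, not the parameter k^2. The integrand is
   unbounded near x = 1; its value at x = 1 itself is 0^-1 = 0, which does not
   affect the Lebesgue integral. *)
Definition ellipticK (R : realType) (k : R) : R :=
  \int[lebesgue_measure]_(x in `[0, 1])
    (1 / Num.sqrt ((1 - x ^+ 2) * (1 - k ^+ 2 * x ^+ 2))).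

(* Main.v *)
Require Import Defs.
From mathcomp Require Import measurable_realfun ring lra.

(** The Lauricella series and the two elliptic integrals are all integrals over
    [0, 1] against the weight 1 / sqrt (1 - s^2).

    Write x_1, x_2, x_3 for the arguments of the series and
    D(s) = prod_j (1 - x_j s^2)^(-1/2). Expanding every factor of D by the
    binomial series and integrating term by term against
    s^2 / sqrt (1 - s^2), where the Wallis integrals produce the missing
    Pochhammer quotient (3/2)_m / (2)_m, gives
      F_D = (4 / pi) int_0^1 s^2 D(s) / sqrt (1 - s^2) ds
    (lauricellaD_half_integral, for any number of variables). This is the
    Euler integral of the series after u = s^2.

    The Euler integrand lives on a genus 2 curve, but x_1 x_2 = x_3 = 1 / b^4
    gives this curve the extra involution s^2 -> b^4 / s^2, and it covers two
    elliptic curves. The two quotient maps send s^2 to x^2 with, for e = 1 and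
    e = -1,
      x = (b^2 - e) s / (b^2 - e s^2),
    an increasing bijection of [0, 1]; they turn
    dx / sqrt ((1 - x^2) (1 - k^2 x^2)), with
    k = b (a^2 - e) / (a (b^2 - e)), into
      (b^2 - e) (b^2 + e s^2) / b^4 * D(s) / sqrt (1 - s^2) ds
    (ellipticK_lauricella_form). Subtracting the case e = -1 from the case
    e = 1 leaves 2 s^2 / b^4 in front of D, hence 2 / b^4 times the integral
    that represents F_D. Finally F_D >= 1, so that dividing by it is
    legitimate.

    All the integrands blow up at the right end of the interval; the first part
    therefore extends the fundamental theorem of calculus and the change of
    variables to nonnegative functions on a half-open interval. *)

Set Implicit Arguments.
Unset Strict Implicit.
Unset Printing Implicit Defensive.

Local Open Scope classical_set_scope.
Local Open Scope ring_scope.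
Local Notation mu := lebesgue_measure.

(** * Integrals with a singularity at the right end *)

Lemma cvg_ge0_integral_bndo (R : realType) (f : R -> R) (a b : R) (c : R^nat) :
  nondecreasing_seq c -> (forall n, c n < b) -> c @ \oo --> b ->
  (forall x, a <= x < b -> 0 <= f x) -> measurable_fun `[a, b[ f ->
  (\int[mu]_(x in `[a, c n]) (f x)%:E @[n --> \oo] -->
   \int[mu]_(x in `[a, b]) (f x)%:E)%E.
Proof.
move=> ndc cb cvc f0 mf.
rewrite -integral_itv_bndo_bndc; last exact/measurable_EFinP.
have bigE : `[a, b[%classic = \bigcup_n `[a, c n]%classic.
  apply/seteqP; split => [x /=|x [n _] /=]; rewrite !in_itv/=.
    move=> /andP[ax xb].
    have [N _ HN] : \forall n \near \oo, x < c n by exact: (cvgr_gt b).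
    by exists N => //=; rewrite in_itv/= ax ltW//; apply: HN => /=.
  by move=> /andP[-> /le_lt_trans->].
rewrite bigE; apply: ge0_nondecreasing_set_cvg_integral => //.
- by move=> m n mn; apply/subsetPset/subset_itvl; rewrite bnd_simp; exact: ndc.
- move=> n; apply/measurable_EFinP; apply: measurable_funS mf => //.
  by apply: subset_itvl; rewrite bnd_simp cb.
- move=> n x /=; rewrite in_itv/= => /andP[ax xc].
  by rewrite lee_fin f0// ax (le_lt_trans xc).
Qed.

Lemma exists_increasing_seq_below (R : realType) (a b : R) : a < b ->
  exists c : R^nat, [/\ nondecreasing_seq c, forall n, a < c n < b & c @ \oo --> b].
Proof.
move=> ab; exists (fun n => b - (b - a) / n.+2%:R); split.
- move=> m n mn; rewrite lerD2l lerN2 ler_pM2l ?subr_gt0//.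
  by rewrite lef_pV2 ?posrE// ler_nat.
- move=> n; have ba : 0 < b - a by rewrite subr_gt0.
  rewrite gtrBl divr_gt0// andbT ltrBrDr -ltrBrDl.
  by rewrite ltr_pdivrMr// ltr_pMr// ltr1n.
- rewrite -[X in _ --> X]subr0 -(mulr0 (b - a)).
  apply: cvgB; first exact: cvg_cst.
  apply: cvgM; first exact: cvg_cst.
  by have := @cvg_harmonic R; rewrite -cvg_shiftS.
Qed.

Lemma continuous_measurable_itvco (R : realType) (f : R -> R) (a b : R) :
  (forall x, a <= x < b -> {for x, continuous f}) -> measurable_fun `[a, b[ f.
Proof.
move=> cf; apply/measurable_fun_itv_obnd_cbndP.
apply: open_continuous_measurable_fun => // x.
by rewrite inE/= in_itv/= => /andP[/ltW ax xb]; apply: cf; rewrite ax.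
Qed.

Lemma continuous_at_within_itv (R : realType) (f : R -> R) (a b : R) :
  (forall x, a <= x <= b -> {for x, continuous f}) ->
  {within `[a, b], continuous f}.
Proof.
by move=> cf; apply: continuous_in_subspaceT => x; rewrite inE/= in_itv/=; apply: cf.
Qed.

(** The function f may be unbounded near b; being nonnegative, it is integrated
    by exhausting [a, b[ with compact intervals, and the result is read off the
    left limit of the primitive at b. *)
Lemma ge0_FTC2_bndo (R : realType) (f F : R -> R) (a b : R) : a < b ->
  (forall x, a <= x < b -> 0 <= f x) ->
  (forall x, a <= x < b -> {for x, continuous f}) ->
  (forall x, a <= x < b -> is_derive x 1 F (f x)) ->
  F x @[x --> b^'-] --> F b ->
  (\int[mu]_(x in `[a, b]) (f x)%:E = (F b - F a)%:E)%E.
Proof.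
move=> ab f0 cf dF Fb.
have [c [ndc acb cvc]] := exists_increasing_seq_below ab.
have cb n : c n < b by have /andP[] := acb n.
have cvI := cvg_ge0_integral_bndo ndc cb cvc f0 (continuous_measurable_itvco cf).
apply: (cvg_unique _ cvI) => //.
have -> : (fun n => \int[mu]_(x in `[a, c n]) (f x)%:E)%E =
          (fun n => (F (c n) - F a)%:E).
  apply/funext => n; have /andP[acn cnb] := acb n.
  have sub x : a <= x <= c n -> a <= x < b.
    by move=> /andP[-> /le_lt_trans]; exact.
  have cF x : a <= x <= c n -> {for x, continuous F}.
    move=> /sub/dF dFx; apply/differentiable_continuous/derivable1_diffP.
    exact: ex_derive.
  rewrite (@continuous_FTC2 _ f F)//.
  - by apply: continuous_at_within_itv => x /sub/cf.
  - split.
    + move=> x; rewrite in_itv/= => /andP[ax xc].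
      by have /dF : a <= x < b by rewrite ltW// (lt_trans xc).
    + by apply: cvg_at_right_filter; apply: cF; rewrite lexx ltW.
    + by apply: cvg_at_left_filter; apply: cF; rewrite lexx ltW.
  - move=> x; rewrite in_itv/= => /andP[ax xc].
    have /dF : a <= x < b by rewrite ltW// (lt_trans xc).
    by rewrite derive1E => ?; rewrite derive_val.
apply: cvg_EFin; first by near=> n.
apply: cvgB; last exact: cvg_cst.
by move/cvg_at_leftP : Fb; apply; split.
Unshelve. all: by end_near. Qed.

(** Both sides are limits of integrals over compact intervals [a, c_n] and
    [F a, F c_n], on which the change of variables for continuous functions
    applies; nonnegativity makes both limits exist, possibly infinite. *)
Lemma ge0_substitution_bndo (R : realType) (F dF G : R -> R) (a b : R) : a < b ->
  (forall x, a <= x < b -> is_derive x 1 F (dF x)) ->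
  (forall x, a <= x < b -> 0 < dF x) ->
  (forall x, a <= x < b -> {for x, continuous dF}) ->
  F x @[x --> b^'-] --> F b ->
  (forall y, F a <= y < F b -> 0 <= G y) ->
  (forall y, F a <= y < F b -> {for y, continuous G}) ->
  (\int[mu]_(y in `[F a, F b]) (G y)%:E =
   \int[mu]_(x in `[a, b]) (G (F x) * dF x)%:E)%E.
Proof.
move=> ab dFE dF0 cdF Fb G0 cG.
have cF x : a <= x < b -> {for x, continuous F}.
  move=> /dFE dFx; apply/differentiable_continuous/derivable1_diffP.
  exact: ex_derive.
have derF x : a <= x < b -> derive1 F x = dF x.
  by move=> /dFE dFx; rewrite derive1E derive_val.
have oo x : x \in `]a, b[ -> a <= x < b.
  by rewrite in_itv/= => /andP[/ltW -> ->].
have dFoo : derivable_oo_LRcontinuous F a b.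
  split => //; first by move=> x /oo/dFE.
  by apply: cvg_at_right_filter; apply: cF; rewrite lexx.
have incF : {in `[a, b] &, {homo F : x y / x < y}}.
  move=> x y; apply: (@gtr0_derive1_lt_cc _ F a b) => //.
  - by move=> z /oo/dFE.
  - by move=> z /oo zab; rewrite derF// dF0.
  - exact: derivable_oo_LRcontinuous_within.
have FI x : a <= x < b -> F a <= F x < F b.
  move=> /andP[ax xb]; apply/andP; split; last first.
    by apply: incF; rewrite ?in_itv/= ?lexx ?ax ?(ltW xb) ?(ltW ab).
  move: ax; rewrite le_eqVlt => /predU1P[->|ax]; first exact: lexx.
  by apply/ltW/incF; rewrite ?in_itv/= ?lexx ?(ltW ax) ?(ltW xb) ?(ltW ab).
have [c [ndc acb cvc]] := exists_increasing_seq_below ab.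
have cb n : c n < b by have /andP[] := acb n.
have cco n : a <= c n < b by have /andP[/ltW -> ->] := acb n.
have cvL : (\int[mu]_(y in `[F a, F (c n)]) (G y)%:E @[n --> \oo] -->
            \int[mu]_(y in `[F a, F b]) (G y)%:E)%E.
  apply: (@cvg_ge0_integral_bndo _ G (F a) (F b) (F \o c)) => //.
  - move=> m n /ndc; rewrite le_eqVlt => /predU1P[/= ->//|cmn].
    by apply/ltW/incF => //; rewrite in_itv/= !(ltW (cb _)) andbT;
      case/andP: (cco m); case/andP: (cco n).
  - by move=> n; have /andP[] := FI _ (cco n).
  - by move/cvg_at_leftP : Fb; apply; split.
  - exact: continuous_measurable_itvco.
have cvR : (\int[mu]_(x in `[a, c n]) (G (F x) * dF x)%:E @[n --> \oo] -->
            \int[mu]_(x in `[a, b]) (G (F x) * dF x)%:E)%E.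
  apply: (@cvg_ge0_integral_bndo _ (fun x => G (F x) * dF x)) => //.
  - by move=> x xab; rewrite mulr_ge0 ?(ltW (dF0 _ _))// G0// FI.
  - apply: continuous_measurable_itvco => x xab.
    apply: continuousM; last exact: cdF.
    by apply: continuous_comp; [exact: cF|exact/cG/FI].
apply: (cvg_unique _ cvL) => //.
suff -> : (fun n => \int[mu]_(y in `[F a, F (c n)]) (G y)%:E)%E =
          (fun n => \int[mu]_(x in `[a, c n]) (G (F x) * dF x)%:E)%E by [].
apply/funext => n; have /andP[acn cnb] := acb n.
have sub x : a <= x <= c n -> a <= x < b.
  by move=> /andP[-> /le_lt_trans]; exact.
have subo x : x \in `]a, c n[ -> a <= x <= c n.
  by rewrite in_itv/= => /andP[/ltW -> /ltW ->].
rewrite integration_by_substitution_increasing ?(ltW acn)//.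
- apply: eq_integral => x; rewrite inE/= in_itv/= => /sub xab.
  by rewrite fctE/= derF.
- move=> x y; rewrite !in_itv/= => xc yc; apply: incF; rewrite in_itv/=.
    by have /andP[-> /ltW ->] := sub _ xc.
  by have /andP[-> /ltW ->] := sub _ yc.
- move=> x xac; have xab : x \in `]a, b[.
    by move: xac; rewrite !in_itv/= => /andP[-> /lt_trans]; exact.
  rewrite /continuous_at derF; last exact: oo.
  apply: cvg_trans (cdF x (oo _ xab)); apply: near_eq_cvg.
  near=> y; rewrite -derF//; apply: oo; near: y; exact: near_in_itvoo.
- apply/cvg_ex; exists (dF a).
  apply: (@cvg_trans _ (dF x @[x --> a^'+])); last first.
    by apply: cvg_at_right_filter; apply: cdF; rewrite lexx.
  apply: near_eq_cvg; near=> y; rewrite -derF//; apply/andP; split.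
    by near: y; exact: nbhs_right_ge.
  by near: y; exact: nbhs_right_lt.
- apply/cvg_ex; exists (dF (c n)).
  apply: (@cvg_trans _ (dF x @[x --> (c n)^'-])); last first.
    by apply: cvg_at_left_filter; apply: cdF.
  apply: near_eq_cvg; near=> y; rewrite -derF//; apply/andP; split.
    by near: y; exact: nbhs_left_ge.
  by apply: lt_trans cnb; near: y; exact: nbhs_left_lt.
- split.
  + by move=> x /subo/sub/dFE.
  + by apply: cvg_at_right_filter; apply: cF; rewrite lexx.
  + by apply: cvg_at_left_filter; apply: cF.
- apply: continuous_at_within_itv => y /andP[ay yc]; apply: cG; rewrite ay.
  by rewrite (le_lt_trans yc)//; have /andP[] := FI _ (cco n).
Unshelve. all: by end_near. Qed.

(** * The binomial series of exponent -1/2 and the Wallis integrals *)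

Lemma is_derive_sqrt_comp (R : realType) (g : R -> R) (x dg : R) :
  0 < g x -> is_derive x 1 g dg ->
  is_derive x 1 (fun y => Num.sqrt (g y)) (dg / (2 * Num.sqrt (g x))).
Proof.
move=> g0 dgx; rewrite mulrC.
exact: (is_derive1_comp (is_derive1_sqrt g0) dgx).
Qed.

Lemma continuous_sqrt_comp (R : realType) (g : R -> R) (x : R) :
  {for x, continuous g} -> {for x, continuous (fun y => Num.sqrt (g y))}.
Proof. by move=> cg; apply: continuous_comp => //; exact: sqrt_continuous. Qed.

Lemma continuous_invsqrt_comp (R : realType) (g : R -> R) (x : R) :
  0 < g x -> {for x, continuous g} ->
  {for x, continuous (fun y => (Num.sqrt (g y))^-1)}.
Proof.
move=> g0 cg; apply: cvgV; first by rewrite gt_eqF// sqrtr_gt0.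
exact: continuous_sqrt_comp.
Qed.

Lemma is_derive_exprn (R : realType) n (x : R) :
  is_derive x 1 (fun y : R => y ^+ n) (n%:R * x ^+ n.-1).
Proof.
rewrite (_ : (fun y => _) = id ^+ n); last by apply/funext => y; rewrite fctE.
by apply: is_derive_eq; rewrite scaler1.
Qed.

Lemma pochhammerS (F : numFieldType) (x : F) n :
  pochhammer x n.+1 = pochhammer x n * (x + n%:R).
Proof. by rewrite /pochhammer big_ord_recr. Qed.

Section half_coefficients.
Context {R : realType}.

(** The coefficient of t^n in (1 - t)^(-1/2). *)
Definition half_coef (n : nat) : R := pochhammer (1 / 2) n / (n`!)%:R.

Lemma half_coef0 : half_coef 0 = 1.
Proof. by rewrite /half_coef /pochhammer big_ord0 fact0 divr1. Qed.

Lemma half_coefS n : half_coef n.+1 = half_coef n * (1 / 2 + n%:R) / n.+1%:R.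
Proof.
rewrite /half_coef pochhammerS factS natrM.
have f0 : (n`!)%:R != 0 :> R by rewrite pnatr_eq0 -lt0n fact_gt0.
have n0 : n.+1%:R != 0 :> R by rewrite pnatr_eq0.
by move: f0 n0; move: (n.+1%:R) => N f0 N0; field; rewrite f0 N0.
Qed.

Lemma half_coef_gt0 n : 0 < half_coef n.
Proof.
elim: n => [|n ih]; first by rewrite half_coef0.
by rewrite half_coefS divr_gt0// mulr_gt0// ltr_wpDr.
Qed.

Lemma half_coef_ge0 n : 0 <= half_coef n.
Proof. exact/ltW/half_coef_gt0. Qed.

Lemma half_coef_le1 n : half_coef n <= 1.
Proof.
elim: n => [|n ih]; first by rewrite half_coef0.
rewrite half_coefS -mulrA mulr_ile1//; first exact/ltW/half_coef_gt0.
by rewrite ler_pdivrMr// mul1r -[n.+1]addn1 natrD; lra.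
Qed.

Definition half_series (n : nat) (t : R) := \sum_(i < n) half_coef i * t ^+ i.

(** The recurrence (n + 1) c_(n+1) = (n + 1/2) c_n makes the derivative of the
    partial sum times sqrt (1 - t) telescope to a single term. It is what
    bounds the distance of this product to its value 1 at t = 0. *)
Lemma is_derive_half_series_sqrt n (t : R) : t < 1 ->
  is_derive t 1 (fun u => half_series n u * Num.sqrt (1 - u))
    (- (n%:R * half_coef n * t ^+ n.-1 / Num.sqrt (1 - t))).
Proof.
move=> t1; have r0 : 0 < Num.sqrt (1 - t) by rewrite sqrtr_gt0 subr_gt0.
have r2 : Num.sqrt (1 - t) ^+ 2 = 1 - t by rewrite sqr_sqrtr// subr_ge0 ltW.
have dsqrt : is_derive t 1 (fun u : R => Num.sqrt (1 - u))
    (- 1 / (2 * Num.sqrt (1 - t))).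
  apply: is_derive_sqrt_comp; first by rewrite subr_gt0.
  by have := is_deriveB (is_derive_cst (1 : R) t 1) (is_derive_id t 1); rewrite sub0r.
elim: n => [|n ih].
  rewrite !mul0r oppr0.
  rewrite (_ : (fun u => _) = cst 0) ?funeqE => [|u].
    exact: is_derive_cst.
  by rewrite /half_series big_ord0 mul0r.
rewrite (_ : (fun u => _) = (fun u => half_series n u * Num.sqrt (1 - u))
    \+ (fun u => half_coef n * (u ^+ n * Num.sqrt (1 - u)))); last first.
  by apply/funext => u; rewrite /half_series big_ord_recr/= mulrDl mulrA.
apply: is_derive_eq.
  apply: is_deriveD.
  apply: is_deriveZ.
  apply: is_deriveM; exact: is_derive_exprn.
rewrite half_coefS /GRing.scale/=; move: (half_coef n) => c.
have rN u : Num.sqrt (1 - t) * u = (1 - t) * u / Num.sqrt (1 - t).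
  by rewrite -{2}r2; field; rewrite gt_eqF.
have n0 : n.+1%:R != 0 :> R by rewrite pnatr_eq0.
have nE : n.+1%:R = n%:R + 1 :> R by rewrite -natr1.
rewrite rN; move: n0; rewrite nE; case: n {ih nE} => [|n] n0 /=.
  by field; rewrite gt_eqF//=; move: n0; rewrite add0r.
rewrite exprS; move: n0; move: (n.+1%:R) => N n0.
by field; rewrite n0 gt_eqF.
Qed.

(** Mean value theorem on [0, t]; the derivative is largest in absolute value
    at t. *)
Lemma half_series_remainder n (t : R) : 0 <= t < 1 ->
  `|half_series n.+1 t * Num.sqrt (1 - t) - 1| <=
    n.+1%:R * t ^+ n.+1 / Num.sqrt (1 - t).
Proof.
move=> /andP[t0 t1].
have dh x : x < 1 -> _ := @is_derive_half_series_sqrt n.+1 x.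
have lt1 x : x \in `]0, t[ -> x < 1.
  by rewrite in_itv/= => /andP[_ /lt_trans]; exact.
have [|c] := @MVT_segment R _ _ 0 t t0 (fun x xt => dh x (lt1 x xt)).
  apply: continuous_at_within_itv => x /andP[_ xt].
  have dhx := dh x (le_lt_trans xt t1).
  exact/differentiable_continuous/derivable1_diffP/ex_derive.
rewrite in_itv/= => /andP[c0 ct].
have -> : half_series n.+1 0 = 1.
  rewrite /half_series big_ord_recl expr0 half_coef0 mulr1 big1 ?addr0// => i _.
  by rewrite expr0n mulr0.
rewrite subr0 sqrtr1 mulr1 => ->.
have c1 : c < 1 by exact: le_lt_trans t1.
have sc0 : 0 < Num.sqrt (1 - c) by rewrite sqrtr_gt0 subr_gt0.
have st0 : 0 < Num.sqrt (1 - t) by rewrite sqrtr_gt0 subr_gt0.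
have : n.+1%:R * half_coef n.+1 <= n.+1%:R.
  by rewrite -[leRHS]mulr1 ler_wpM2l// half_coef_le1.
have : 0 <= n.+1%:R * half_coef n.+1 by rewrite mulr_ge0// half_coef_ge0.
move: (_ * half_coef _) => k k0 kn.
have kc0 : 0 <= k * c ^+ n by rewrite mulr_ge0// exprn_ge0.
rewrite subr0 mulNr normrN ger0_norm; last first.
  by rewrite mulr_ge0// divr_ge0// ltW.
rewrite mulrAC exprSr mulrA; apply: ler_pM; first by rewrite mulr_ge0.
- by rewrite invr_ge0 ltW.
- by rewrite ler_wpM2r// ler_pM ?exprn_ge0// lerXn2r ?nnegrE.
- by rewrite lef_pV2 ?posrE// ler_wsqrtr// lerD2l lerN2.
Qed.

(** Linear growth is absorbed by one factor r^n; with r = sqrt t, the other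
    factor r^n of t^n still tends to 0. *)
Lemma natr_expr_le (r : R) n : 0 <= r < 1 -> n%:R * r ^+ n <= (1 - r)^-1.
Proof.
move=> /andP[r0 r1]; have r1' : 0 < 1 - r by rewrite subr_gt0.
rewrite -[leRHS]mul1r ler_pdivlMr//.
suff : n%:R * r ^+ n * (1 - r) <= 1 - r ^+ n.
  by move=> /le_trans; apply; rewrite gerBl exprn_ge0.
elim: n => [|n ih]; first by rewrite !mul0r expr0 subrr.
have rn1 : r * r ^+ n <= 1 by rewrite -exprS exprn_ile1// ltW.
by rewrite -natr1 exprS; nra.
Qed.

Lemma half_binomial (t : R) : 0 <= t < 1 ->
  half_series n t @[n --> \oo] --> (Num.sqrt (1 - t))^-1.
Proof.
move=> t01; have /andP[t0 t1] := t01.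
set s := Num.sqrt (1 - t); have s0 : 0 < s by rewrite sqrtr_gt0 subr_gt0.
set r := Num.sqrt t; have r0 : 0 <= r by exact: sqrtr_ge0.
have r1 : r < 1 by rewrite -sqrtr1 ltr_sqrt.
have tE : t = r ^+ 2 by rewrite sqr_sqrtr.
suff : half_series n.+1 t * s @[n --> \oo] --> (1 : R).
  rewrite (@cvg_shiftS _ (fun n => half_series n t * s)) => h.
  rewrite -[X in _ --> X]mul1r.
  rewrite (_ : (fun n => _) = (fun n => half_series n t * s / s)).
    by apply: cvgM => //; exact: cvg_cst.
  by apply/funext => n; rewrite mulfK// gt_eqF.
pose e n := (1 - r)^-1 / s * r ^+ n.+1.
have e0 : e n @[n --> \oo] --> (0 : R).
  rewrite -(mulr0 ((1 - r)^-1 / s)); apply: cvgM; first exact: cvg_cst.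
  by rewrite (@cvg_shiftS _ (fun n => r ^+ n)); apply: cvg_expr; rewrite ger0_norm.
apply: (@squeeze_cvgr _ _ _ _ (fun n => 1 - e n) (fun n => 1 + e n)).
- near=> n; rewrite -ler_distl (le_trans (half_series_remainder n t01))//.
  rewrite -/s /e [leRHS]mulrAC ler_pM2r ?invr_gt0// tE -exprM mul2n -addnn exprD mulrA.
  by rewrite ler_wpM2r ?exprn_ge0// natr_expr_le// r0.
- by rewrite -[X in _ --> X]subr0; apply: cvgB => //; exact: cvg_cst.
- by rewrite -[X in _ --> X]addr0; apply: cvgD => //; exact: cvg_cst.
Unshelve. all: by end_near. Qed.

Lemma half_series_ge0 n (t : R) : 0 <= t -> 0 <= half_series n t.
Proof.
by move=> t0; apply: sumr_ge0 => i _; rewrite mulr_ge0 ?exprn_ge0 ?half_coef_ge0//.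
Qed.

Lemma nondecreasing_half_series (t : R) : 0 <= t ->
  nondecreasing_seq (half_series ^~ t).
Proof.
move=> t0; apply/nondecreasing_seqP => n.
by rewrite /half_series big_ord_recr/= lerDl mulr_ge0 ?exprn_ge0 ?half_coef_ge0//.
Qed.

(** Primitives of s^(2n) / sqrt (1 - s^2), by the reduction formula obtained
    from the derivative of s^(2n+1) sqrt (1 - s^2). The first one is asin in
    half-angle form, whose continuity at s = 1 is that of a composition. *)
Fixpoint wallis_prim (n : nat) (s : R) : R :=
  if n is m.+1 then
    (m.*2.+1%:R * wallis_prim m s - s ^+ m.*2.+1 * Num.sqrt (1 - s ^+ 2))
      / m.+1.*2%:R
  else 2 * atan (s / (1 + Num.sqrt (1 - s ^+ 2))).

Lemma continuous_1BMsqr (x s : R) : {for s, continuous (fun s : R => 1 - x * s ^+ 2)}.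
Proof.
apply: cvgB; first exact: cvg_cst.
by apply: cvgM; [exact: cvg_cst|exact: exprn_continuous].
Qed.

Lemma continuous_sqrt1B (s : R) : {for s, continuous (fun s : R => Num.sqrt (1 - s ^+ 2))}.
Proof.
apply: continuous_sqrt_comp; apply: cvgB; first exact: cvg_cst.
exact: exprn_continuous.
Qed.

Lemma wallis_prim0 n : wallis_prim n 0 = 0.
Proof.
elim: n => [|n ih] /=; first by rewrite mul0r atan0 mulr0.
by rewrite ih expr0n mulr0 mul0r subrr mul0r.
Qed.

Lemma wallis_prim1 n : wallis_prim n 1 = pi / 2 * half_coef n.
Proof.
elim: n => [|n ih] /=.
  by rewrite expr1n subrr sqrtr0 addr0 divr1 atan1 half_coef0; field.
rewrite ih half_coefS !expr1n subrr sqrtr0 mulr0 subr0.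
rewrite -addnn -[_.+1]addn1 -[n.+1]addn1 -addnn !natrD.
have : n%:R + 1 != 0 :> R by rewrite natr1 pnatr_eq0.
move: (n%:R) => N N0; by field; rewrite N0 -mulr2n mulrn_eq0.
Qed.

Lemma continuous_wallis_prim n (s : R) : {for s, continuous (wallis_prim n)}.
Proof.
elim: n => [|n ih] /=.
  have cq : {for s, continuous (fun s : R => s / (1 + Num.sqrt (1 - s ^+ 2)))}.
    apply: cvgM; first exact: cvg_id.
    apply: cvgV; first by rewrite gt_eqF// ltr_pwDl// sqrtr_ge0.
    by apply: cvgD; [exact: cvg_cst|exact: continuous_sqrt1B].
  have cA := continuous_comp cq (@continuous_atan R _).
  by apply: cvgM; [exact: cvg_cst|exact: cA].
apply: cvgM; last exact: cvg_cst.
apply: cvgB; first by apply: cvgM => //; exact: cvg_cst.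
by apply: cvgM; [exact: exprn_continuous|exact: continuous_sqrt1B].
Qed.

Lemma is_derive_wallis_prim n (s : R) : -1 < s < 1 ->
  is_derive s 1 (wallis_prim n) (s ^+ n.*2 / Num.sqrt (1 - s ^+ 2)).
Proof.
move=> s11; have p0 : 0 < 1 - s ^+ 2 by nra.
have r0 : 0 < Num.sqrt (1 - s ^+ 2) by rewrite sqrtr_gt0.
have r2 : Num.sqrt (1 - s ^+ 2) ^+ 2 = 1 - s ^+ 2 by rewrite sqr_sqrtr// ltW.
have dr : is_derive s 1 (fun s => Num.sqrt (1 - s ^+ 2))
    (- s / Num.sqrt (1 - s ^+ 2)).
  have d1 : is_derive s 1 (fun s => 1 - s ^+ 2) _ :=
    is_deriveB (is_derive_cst (1 : R) s 1) (is_derive_exprn 2 s).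
  have h := @is_derive_sqrt_comp R (fun s => 1 - s ^+ 2) s _ p0 d1.
  apply: (is_derive_eq h).
  by rewrite sub0r expr1; field; rewrite gt_eqF.
set r := Num.sqrt _ in r0 r2 dr *.
have r1 : 1 + r != 0 by rewrite gt_eqF// ltr_pwDl// ltW.
elim: n => [|n ih] /=.
  pose d (u : R) := 1 + Num.sqrt (1 - u ^+ 2).
  have dd : is_derive s 1 d _ := is_deriveD (is_derive_cst (1 : R) s 1) dr.
  have dq : is_derive s 1 (fun u => u / d u) _ :=
    is_deriveM (is_derive_id s 1) (@is_deriveV R d s _ 1 r1 dd).
  have dA : is_derive s 1 (fun u => 2 * atan (u / d u)) _ :=
    is_deriveZ 2 (@is_derive1_comp R atan (fun u => u / d u) s _ _
      (is_derive1_atan (s / d s)) dq).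
  apply: (is_derive_eq dA).
  have s2 : s ^+ 2 = 1 - r ^+ 2 by rewrite r2; ring.
  rewrite /d -/r /GRing.scale/= add0r double0 expr0.
  rewrite (_ : 1 + (s / (1 + r)) ^+ 2 = 2 / (1 + r)); last first.
    by rewrite expr_div_n s2; field.
  rewrite (_ : s * _ = s ^+ 2 / ((1 + r) ^+ 2 * r)); last first.
    by field; rewrite r1 gt_eqF.
  by rewrite s2; field; rewrite r1 gt_eqF.
have dp := is_deriveM (is_derive_exprn n.*2.+1 s) dr.
have dn := is_deriveB (is_deriveZ n.*2.+1%:R ih) dp.
apply: (is_derive_eq _ (esym _)).
rewrite !scaler0 add0r /GRing.scale/= -/r.
have rN u : r * u = (1 - s ^+ 2) * u / r by rewrite -r2; field; rewrite gt_eqF.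
have ME : n.+1.*2%:R = n.*2.+1%:R + 1 :> R by rewrite doubleS -natr1.
have : n.*2.+1%:R + 1 != 0 :> R by rewrite natr1 pnatr_eq0.
rewrite rN ME doubleS !exprS; move: (n.*2.+1%:R) => N N0.
by field; rewrite N0 gt_eqF.
Qed.

Lemma wallis n :
  (\int[@lebesgue_measure R]_(s in `[0%R, 1%R]) (s ^+ n.*2 / Num.sqrt (1 - s ^+ 2))%:E =
   (pi / 2 * half_coef n)%:E)%E.
Proof.
have dW (s : R) : 0 <= s < 1 ->
    is_derive s 1 (wallis_prim n) (s ^+ n.*2 / Num.sqrt (1 - s ^+ 2)).
  move=> /andP[s0 s1]; apply: is_derive_wallis_prim.
  by rewrite s1 (lt_le_trans _ s0)// ltrN10.
rewrite (ge0_FTC2_bndo (@ltr01 R) _ _ dW) ?wallis_prim0 ?subr0 ?wallis_prim1//.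
- by move=> s /andP[s0 s1]; rewrite divr_ge0 ?exprn_ge0 ?sqrtr_ge0.
- move=> s /andP[s0 s1]; apply: cvgM; first exact: exprn_continuous.
  apply: (@continuous_invsqrt_comp R (fun s => 1 - s ^+ 2)); first by nra.
  by apply: cvgB; [exact: cvg_cst|exact: exprn_continuous].
- by rewrite -wallis_prim1; apply: cvg_at_left_filter; exact: continuous_wallis_prim.
Qed.

End half_coefficients.

(** * The Lauricella series as an integral *)

Section weight.
Context {R : realType}.

Lemma measurable_invsqrt1B :
  measurable_fun `[(0 : R), 1] (fun s : R => (Num.sqrt (1 - s ^+ 2))^-1).
Proof.
apply/measurable_fun_itv_bndo_bndcP; apply: continuous_measurable_itvco.
move=> s /andP[s0 s1].
apply: (@continuous_invsqrt_comp R (fun s => 1 - s ^+ 2)); first by nra.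
by apply: cvgB; [exact: cvg_cst|exact: exprn_continuous].
Qed.

Lemma continuous_measurable_itvcc (h : R -> R) (a b : R) :
  (forall s, a <= s <= b -> {for s, continuous h}) -> measurable_fun `[a, b] h.
Proof.
move=> ch; apply: subspace_continuous_measurable_fun => //.
exact: continuous_at_within_itv.
Qed.

(** A continuous function is bounded on [0, 1], and the weight is integrable by
    the Wallis integral for n = 0. *)
Lemma integrable_div_sqrt1B (h : R -> R) :
  (forall s, 0 <= s <= 1 -> {for s, continuous h}) ->
  (@lebesgue_measure R).-integrable `[(0 : R), 1]
    (EFin \o (fun s => h s / Num.sqrt (1 - s ^+ 2))).
Proof.
move=> ch.
have wint : (@lebesgue_measure R).-integrable `[(0 : R), 1]
    (EFin \o (fun s : R => (Num.sqrt (1 - s ^+ 2))^-1)).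
  apply/integrableP; split.
    by apply/measurable_EFinP; exact: measurable_invsqrt1B.
  suff -> : (\int[@lebesgue_measure R]_(s in `[0%R, 1%R])
      `|((Num.sqrt (1 - s ^+ 2))^-1)%:E| = (pi / 2 * half_coef 0)%:E)%E by rewrite ltry.
  rewrite -wallis; apply: eq_integral.
  by move=> s _ /=; rewrite expr0 div1r ger0_norm//.
have := @integrableMr _ _ _ (@lebesgue_measure R) `[(0 : R), 1] _ h _ _ _ wint.
apply => //; first exact: continuous_measurable_itvcc.
have /compact_bounded := continuous_compact (continuous_at_within_itv ch) (@segment_compact R 0 1).
move=> [M [Mr HM]]; exists M; split => // x xM s s01.
by apply: (HM x xM); exists s.
Qed.

End weight.

Lemma cvg_prod_ord (R : realType) (T : Type) (F : set_system T) {FF : Filter F} m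
    (f : 'I_m -> T -> R) (a : 'I_m -> R) :
  (forall j, f j t @[t --> F] --> a j) ->
  \prod_(j < m) f j t @[t --> F] --> \prod_(j < m) a j.
Proof. by move=> h; apply: cvg_big => //; exact: mul_continuous. Qed.

Section lauricella_integral.
Context {R : realType} (n : nat) (x : n.-tuple R).
Context (x01 : forall j, 0 <= tnth x j < 1).

Definition inv_sqrt_prod (s : R) : R :=
  \prod_(j < n) (Num.sqrt (1 - tnth x j * s ^+ 2))^-1.

Definition half_series_prod (N : nat) (s : R) : R :=
  \prod_(j < n) half_series N (tnth x j * s ^+ 2).

Lemma mul_sqr_itv j (s : R) : 0 <= s <= 1 -> 0 <= tnth x j * s ^+ 2 < 1.
Proof.
move=> /andP[s0 s1]; have /andP[xj0 xj1] := x01 j.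
rewrite mulr_ge0 ?exprn_ge0//= (le_lt_trans _ xj1)//.
by rewrite ler_piMr// exprn_ile1.
Qed.

Lemma cvg_half_series_prod s : 0 <= s <= 1 ->
  half_series_prod N s @[N --> \oo] --> inv_sqrt_prod s.
Proof. by move=> s01; apply: cvg_prod_ord => j; apply: half_binomial; exact: mul_sqr_itv. Qed.

Lemma half_series_prod_ge0 N s : 0 <= s <= 1 -> 0 <= half_series_prod N s.
Proof.
move=> s01; apply: prodr_ge0 => j _; apply: half_series_ge0.
by have /andP[] := mul_sqr_itv j s01.
Qed.

Lemma nondecreasing_half_series_prod s : 0 <= s <= 1 ->
  nondecreasing_seq (half_series_prod ^~ s).
Proof.
move=> s01 M N MN; apply: ler_prod => j _.
have /andP[xs0 _] := mul_sqr_itv j s01.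
by rewrite half_series_ge0// nondecreasing_half_series.
Qed.

Lemma continuous_inv_sqrt_prod s : 0 <= s <= 1 ->
  {for s, continuous inv_sqrt_prod}.
Proof.
move=> s01; apply: cvg_prod_ord => j.
apply: (@continuous_invsqrt_comp R (fun s => 1 - tnth x j * s ^+ 2)).
  by rewrite subr_gt0; have /andP[] := mul_sqr_itv j s01.
exact: continuous_1BMsqr.
Qed.

Lemma continuous_half_series_prod N (s : R) : {for s, continuous (half_series_prod N)}.
Proof.
apply: cvg_prod_ord => j; apply: cvg_big => [|i _]; first exact: add_continuous.
apply: cvgM; first exact: cvg_cst.
have c2 : {for s, continuous (fun s : R => tnth x j * s ^+ 2)}.
  by apply: cvgM; [exact: cvg_cst|exact: exprn_continuous].
exact: (continuous_comp c2 (@exprn_continuous R i _)).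
Qed.

Definition lauricella_coef N (f : {ffun 'I_n -> 'I_N}) : R :=
  \prod_(j < n) (half_coef (f j) * tnth x j ^+ f j).

(** The cubic truncation of the multiple series is the one for which the
    truncated sum factors into one-variable partial sums. *)
Lemma half_series_prodE N s :
  half_series_prod N s =
  \sum_(f : {ffun 'I_n -> 'I_N}) lauricella_coef f * s ^+ (\sum_j f j)%N.*2.
Proof.
rewrite /half_series_prod /half_series bigA_distr_bigA/=.
apply: eq_bigr => f _; rewrite -mul2n exprM expr_sum -big_split/=.
by apply: eq_bigr => j _; rewrite exprMn mulrA.
Qed.

(** This quotient turns the Wallis integral of s^(2m+2) into the factor that
    depends on the total degree m in the Lauricella series. *)
Lemma half_coef_pochhammer m :
  half_coef m.+1 = 1 / 2 * (pochhammer (3 / 2) m / pochhammer 2 m) :> R.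
Proof.
elim: m => [|m ih].
  rewrite half_coefS half_coef0 /pochhammer !big_ord0 mul1r addr0 !divr1.
  by rewrite mulr1.
have p0 : pochhammer 2 m != 0 :> R.
  by rewrite gt_eqF// prodr_gt0// => i _; rewrite ltr_wpDr.
rewrite half_coefS ih !pochhammerS -natr1 -[m.+1%:R]natr1.
have m2 : 2 + m%:R != 0 :> R by rewrite gt_eqF// ltr_wpDr.
by field; rewrite m2.
Qed.

Local Notation halves := [tuple 1 / 2 | j < n].

Lemma lauricellaD_partial_half N :
  lauricellaD_partial (3 / 2) halves 2 x N =
  \sum_(f : {ffun 'I_n -> 'I_N})
    lauricella_coef f * (2 * half_coef (\sum_j f j)%N.+1).
Proof.
apply: eq_bigr => f _; rewrite half_coef_pochhammer /lauricella_coef.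
under [X in _ * X / _]eq_bigr do rewrite tnth_mktuple.
rewrite big_split/= /half_coef prodf_div.
have g0 : \prod_(j < n) ((f j)`!)%:R != 0 :> R.
  by apply/prodf_neq0 => j _; rewrite pnatr_eq0 -lt0n fact_gt0.
have p0 : pochhammer 2 (\sum_j f j) != 0 :> R.
  by rewrite gt_eqF// prodr_gt0// => i _; rewrite ltr_wpDr.
by field; rewrite g0 p0.
Qed.

Lemma lauricella_coef_ge0 N (f : {ffun 'I_n -> 'I_N}) : 0 <= lauricella_coef f.
Proof.
apply: prodr_ge0 => j _; have /andP[xj0 _] := x01 j.
by rewrite mulr_ge0 ?half_coef_ge0 ?exprn_ge0.
Qed.

Lemma integral_half_series_prod N :
  (\int[@lebesgue_measure R]_(s in `[0%R, 1%R])
     (s ^+ 2 * half_series_prod N s / Num.sqrt (1 - s ^+ 2))%:E =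
   (pi / 4 * lauricellaD_partial (3 / 2) halves 2 x N)%:E)%E.
Proof.
have mW k : measurable_fun `[(0 : R), 1] (fun s : R => s ^+ k / Num.sqrt (1 - s ^+ 2)).
  apply: measurable_funM; last exact: measurable_invsqrt1B.
  by apply: continuous_measurable_itvcc => s _; exact: exprn_continuous.
have W0 k (s : R) : `[0, 1]%classic s -> 0 <= s ^+ k / Num.sqrt (1 - s ^+ 2).
  by rewrite /= in_itv/= => /andP[s0 _]; rewrite divr_ge0 ?exprn_ge0 ?sqrtr_ge0.
transitivity (\int[@lebesgue_measure R]_(s in `[0%R, 1%R])
   \sum_(f : {ffun 'I_n -> 'I_N}) ((lauricella_coef f)%:E *
      (s ^+ (\sum_j f j)%N.+1.*2 / Num.sqrt (1 - s ^+ 2))%:E))%E.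
  apply: eq_integral => s _; rewrite half_series_prodE.
  under [RHS]eq_bigr do rewrite -EFinM.
  rewrite sumEFin; congr (_%:E); rewrite mulr_sumr mulr_suml.
  by apply: eq_bigr => f _; rewrite doubleS !exprS; ring.
rewrite ge0_integral_sum//; last 2 first.
- move=> f; apply/measurable_EFinP; by apply: measurable_funM; [exact: measurable_cst|exact: mW].
- move=> f s s01; rewrite -EFinM lee_fin mulr_ge0 ?lauricella_coef_ge0//.
  exact: W0.
transitivity (\sum_(f : {ffun 'I_n -> 'I_N})
    ((lauricella_coef f)%:E * (pi / 2 * half_coef (\sum_j f j)%N.+1)%:E))%E.
  apply: eq_bigr => f _; rewrite ge0_integralZl_EFin ?lauricella_coef_ge0//.
  - by rewrite wallis.
  - by move=> s s01; rewrite lee_fin; exact: W0.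
  - by apply/measurable_EFinP; exact: mW.
under [LHS]eq_bigr do rewrite -EFinM.
rewrite sumEFin lauricellaD_partial_half mulr_sumr; congr (_%:E).
by apply: eq_bigr => f _; field.
Qed.

Lemma lauricellaD_partial_half_ge1 N :
  1 <= lauricellaD_partial (3 / 2) halves 2 x N.+1.
Proof.
rewrite lauricellaD_partial_half (bigD1 [ffun=> ord0])//=.
have -> : (\sum_j ([ffun=> ord0] : {ffun 'I_n -> 'I_N.+1}) j)%N = 0%N.
  by rewrite big1// => j _; rewrite ffunE.
have -> : lauricella_coef ([ffun=> ord0] : {ffun 'I_n -> 'I_N.+1}) = 1.
  by apply: big1 => j _; rewrite ffunE half_coef0 expr0 mulr1.
have -> : 2 * half_coef 1 = 1 :> R by rewrite half_coefS half_coef0; field.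
rewrite mulr1 lerDl; apply: sumr_ge0 => f _.
by rewrite mulr_ge0 ?lauricella_coef_ge0// mulr_ge0// half_coef_ge0.
Qed.

(** Monotone convergence: the truncated products increase to D and their
    integrals are the truncated series. The limit is finite because D is
    continuous on [0, 1], so the series converges in the real line. It is at least 1 because its terms
    are nonnegative and the first one is 1. *)
Lemma lauricellaD_half_integral :
  (\int[@lebesgue_measure R]_(s in `[0%R, 1%R])
    (s ^+ 2 * inv_sqrt_prod s / Num.sqrt (1 - s ^+ 2))%:E =
  (pi / 4 * lauricellaD (3 / 2) halves 2 x)%:E)%E /\
  1 <= lauricellaD (3 / 2) halves 2 x.
Proof.
set I := (X in X = _).
have Ifin : I \is a fin_num.
  apply: integrable_fin_num => //; apply: integrable_div_sqrt1B => s s01.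
  apply: cvgM; first exact: exprn_continuous.
  exact: continuous_inv_sqrt_prod.
have pi0 : pi != 0 :> R by rewrite gt_eqF// pi_gt0.
have pi4 u : 4 / pi * (pi / 4 * u) = u :> R.
  by move: pi pi0 => p p0; field.
have cvI : ((pi / 4 * lauricellaD_partial (3 / 2) halves 2 x N)%:E @[N --> \oo] --> I)%E.
  under eq_fun do rewrite -integral_half_series_prod.
  have -> : I = (\int[@lebesgue_measure R]_(s in `[0%R, 1%R])
     limn (fun N => (s ^+ 2 * half_series_prod N s / Num.sqrt (1 - s ^+ 2))%:E))%E.
    apply: eq_integral => s; rewrite inE/= in_itv/= => s01.
    apply/esym/cvg_lim => //; apply: cvg_EFin; first by near=> N.
    apply: cvgM; last exact: cvg_cst.
    by apply: cvgM; [exact: cvg_cst|exact: cvg_half_series_prod].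
  apply: (@cvg_monotone_convergence _ _ _ (@lebesgue_measure R) `[(0 : R), 1] _
    (fun N s => (s ^+ 2 * half_series_prod N s / Num.sqrt (1 - s ^+ 2))%:E)) => //.
  - move=> N; apply/measurable_EFinP; apply: measurable_funM.
      apply: continuous_measurable_itvcc => s _; apply: cvgM.
        exact: exprn_continuous.
      exact: continuous_half_series_prod.
    exact: measurable_invsqrt1B.
  - move=> N s; rewrite /= in_itv/= => s01.
    by rewrite lee_fin divr_ge0 ?sqrtr_ge0// mulr_ge0 ?sqr_ge0 ?half_series_prod_ge0.
  - move=> s; rewrite /= in_itv/= => s01 M N MN.
    rewrite lee_fin ler_wpM2r ?invr_ge0 ?sqrtr_ge0// ler_wpM2l ?sqr_ge0//.
    exact: nondecreasing_half_series_prod.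
have cvL : lauricellaD_partial (3 / 2) halves 2 x N @[N --> \oo] --> 4 / pi * fine I.
  move: cvI; rewrite -{1}(fineK Ifin) => /fine_cvg /= cvI.
  rewrite (_ : (fun N => _) = (fun N => 4 / pi *
      (pi / 4 * lauricellaD_partial (3 / 2) halves 2 x N))).
    by apply: cvgM; [exact: cvg_cst|exact: cvI].
  by apply/funext => N; rewrite pi4.
have -> : lauricellaD (3 / 2) halves 2 x = 4 / pi * fine I by exact/cvg_lim.
split.
  by rewrite mulrCA pi4 fineK.
rewrite -(cvg_lim _ cvL)//; apply: limr_ge; first by apply/cvg_ex; exists (4 / pi * fine I).
near=> N.
have N0 : (0 < N)%N by near: N; exact: nbhs_infty_gt.
by rewrite -(prednK N0); exact: lauricellaD_partial_half_ge1.
Unshelve. all: by end_near. Qed.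

End lauricella_integral.

(** * Reduction of the elliptic integrals *)

Section quad_subst.
Context {R : realType} (c e : R) (c1 : 1 < c) (e2 : e ^+ 2 = 1).

(** Its square is, as a function of s^2, invariant under s^2 -> c^2 / s^2: it is
    the quotient map of the genus 2 curve onto an elliptic curve, for c = b^2
    and e = 1 or e = -1. *)
Definition quad_subst (s : R) : R := (c - e) * s / (c - e * s ^+ 2).

Definition quad_subst_deriv (s : R) : R :=
  (c - e) * (c + e * s ^+ 2) / (c - e * s ^+ 2) ^+ 2.

Let e_itv : -1 <= e <= 1.
Proof. by move/eqP : e2; rewrite sqrf_eq1 => /orP[]/eqP ->; lra. Qed.

Lemma quad_subst_den_gt0 s : 0 <= s <= 1 -> 0 < c - e * s ^+ 2.
Proof.
move: e_itv => /andP[e0 e1] /andP[s0 s1].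
have : s ^+ 2 <= 1 by rewrite exprn_ile1.
have : 0 <= s ^+ 2 by rewrite sqr_ge0.
move: (s ^+ 2) => t t0 t1; have : e * t <= t by rewrite ler_piMl.
by move: c1; lra.
Qed.

Lemma quad_subst_num_gt0 s : 0 <= s <= 1 -> 0 < c + e * s ^+ 2.
Proof.
move: e_itv => /andP[e0 e1] /andP[s0 s1].
have : s ^+ 2 <= 1 by rewrite exprn_ile1.
have : 0 <= s ^+ 2 by rewrite sqr_ge0.
move: (s ^+ 2) => t t0 t1; have : - e * t <= t by rewrite ler_piMl// lerNl.
by move: c1; lra.
Qed.

Let ce0 : 0 < c - e.
Proof. by move: e_itv => /andP[_ e1]; rewrite subr_gt0 (le_lt_trans e1). Qed.

Lemma quad_subst0 : quad_subst 0 = 0.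
Proof. by rewrite /quad_subst mulr0 mul0r. Qed.

Lemma quad_subst1 : quad_subst 1 = 1.
Proof. by rewrite /quad_subst expr1n !mulr1 divff// gt_eqF. Qed.

Lemma continuous_addMsqr (d s : R) : {for s, continuous (fun s : R => c + d * s ^+ 2)}.
Proof.
apply: cvgD; first exact: cvg_cst.
by apply: cvgM; [exact: cvg_cst|exact: exprn_continuous].
Qed.

Lemma is_derive_quad_subst (s : R) : 0 <= s <= 1 -> is_derive s 1 quad_subst (quad_subst_deriv s).
Proof.
move=> s01; have d0 : c - e * s ^+ 2 != 0 by rewrite gt_eqF// quad_subst_den_gt0.
have dd : is_derive s 1 (fun u : R => c - e * u ^+ 2) _ :=
  is_deriveB (is_derive_cst c s 1) (is_deriveZ e (is_derive_exprn 2 s)).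
have dq : is_derive s 1 quad_subst _ :=
  is_deriveM (is_deriveZ (c - e) (is_derive_id s 1))
    (@is_deriveV R (fun u => c - e * u ^+ 2) s _ 1 d0 dd).
apply: (is_derive_eq dq).
rewrite /quad_subst_deriv /GRing.scale/= sub0r.
by rewrite -[(c - e) *: s]/((c - e) * s); field.
Qed.

Lemma continuous_quad_subst_deriv (s : R) : 0 <= s <= 1 ->
  {for s, continuous quad_subst_deriv}.
Proof.
move=> s01; apply: cvgM.
  by apply: cvgM; [exact: cvg_cst|exact: continuous_addMsqr].
apply: cvgV; first by rewrite expf_neq0// gt_eqF// quad_subst_den_gt0.
have cd : {for s, continuous (fun s : R => c - e * s ^+ 2)}.
  apply: cvgB; first exact: cvg_cst.
  by apply: cvgM; [exact: cvg_cst|exact: exprn_continuous].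
exact: (continuous_comp cd (@exprn_continuous R 2 _)).
Qed.

Lemma quad_subst_deriv_gt0 (s : R) : 0 <= s <= 1 -> 0 < quad_subst_deriv s.
Proof.
move=> s01; apply: divr_gt0; last by rewrite exprn_gt0// quad_subst_den_gt0.
by apply: mulr_gt0; [exact: ce0|exact: quad_subst_num_gt0].
Qed.

Lemma ellipticK_quad_subst (k : R) : 0 <= k < 1 ->
  ellipticK k = fine (\int[@lebesgue_measure R]_(s in `[0%R, 1%R])
    (1 / Num.sqrt ((1 - quad_subst s ^+ 2) * (1 - k ^+ 2 * quad_subst s ^+ 2))
      * quad_subst_deriv s)%:E)%E.
Proof.
move=> /andP[k0 k1]; congr fine.
pose G (x : R) := 1 / Num.sqrt ((1 - x ^+ 2) * (1 - k ^+ 2 * x ^+ 2)).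
have w s : 0 <= s < 1 -> 0 <= s <= 1 by move=> /andP[-> /ltW ->].
have dl (s : R) : 0 <= s < 1 -> is_derive s 1 quad_subst (quad_subst_deriv s).
  by move=> /w/is_derive_quad_subst.
have := @ge0_substitution_bndo R quad_subst quad_subst_deriv G 0 1 ltr01 dl.
rewrite quad_subst0 quad_subst1; apply.
- by move=> s /w/quad_subst_deriv_gt0.
- by move=> s /w/continuous_quad_subst_deriv.
- rewrite -[X in _ --> X]quad_subst1; apply: cvg_at_left_filter.
  have /is_derive_quad_subst d1 : 0 <= (1 : R) <= 1 by rewrite ler01 lexx.
  exact/differentiable_continuous/derivable1_diffP/ex_derive.
- by move=> y _; rewrite divr_ge0// sqrtr_ge0.
- move=> y /andP[y0 y1]; apply: cvgM; first exact: cvg_cst.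
  have y2 : y ^+ 2 < 1 by rewrite exprn_ilt1.
  have k2 : k ^+ 2 <= 1 by rewrite exprn_ile1// ltW.
  apply: (@continuous_invsqrt_comp R (fun x => (1 - x ^+ 2) * (1 - k ^+ 2 * x ^+ 2))).
    rewrite mulr_gt0 ?subr_gt0//.
    by rewrite (le_lt_trans _ y2)// ler_piMl// sqr_ge0.
  apply: cvgM; last exact: continuous_1BMsqr.
  by apply: cvgB; [exact: cvg_cst|exact: exprn_continuous].
Qed.

End quad_subst.

Definition lauricella_args (R : realType) (a b : R) : 3.-tuple R :=
  [tuple a ^+ 2 / b ^+ 2; 1 / (a ^+ 2 * b ^+ 2); 1 / b ^+ 4].

Section lauricella_form.
Context {R : realType} (a b : R) (ha : 1 < a) (hab : a < b).

Let a0 : 0 < a. Proof. exact: lt_trans ha. Qed.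
Let b1 : 1 < b. Proof. exact: lt_trans hab. Qed.
Let b0 : 0 < b. Proof. exact: lt_trans b1. Qed.

Lemma lauricella_args_itv j : 0 <= tnth (lauricella_args a b) j < 1.
Proof.
have a2 : 1 < a ^+ 2 by rewrite exprn_egt1.
have b2 : 1 < b ^+ 2 by rewrite exprn_egt1.
have b4 : 1 < b ^+ 4 by rewrite exprn_egt1.
have ab2 : a ^+ 2 < b ^+ 2 by rewrite ltr_pXn2r ?nnegrE ?ltW.
have ab1 : 1 < a ^+ 2 * b ^+ 2 by rewrite mulr_egt1.
have inv01 (u v : R) : 0 <= u < v -> 0 <= u / v < 1.
  move=> /andP[u0 uv]; have v0 := le_lt_trans u0 uv.
  by rewrite divr_ge0 ?(ltW v0)//= ltr_pdivrMr// mul1r.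
case: j => -[|[|[|//]]] /= ?; rewrite (tnth_nth 0)/=; apply: inv01.
- by rewrite sqr_ge0.
- by rewrite ler01.
- by rewrite ler01.
Qed.

Lemma inv_sqrt_prod_lauricella_args s : inv_sqrt_prod (lauricella_args a b) s =
  (Num.sqrt (1 - a ^+ 2 / b ^+ 2 * s ^+ 2))^-1 *
  (Num.sqrt (1 - 1 / (a ^+ 2 * b ^+ 2) * s ^+ 2))^-1 *
  (Num.sqrt (1 - 1 / b ^+ 4 * s ^+ 2))^-1.
Proof.
by rewrite /inv_sqrt_prod !big_ord_recl big_ord0 mulr1 mulrA !(tnth_nth 0).
Qed.

(** The quantities 1 - x^2 and 1 - k^2 x^2 have the common denominator
    (b^2 - e s^2)^2; as e^2 = 1, the numerators are
    (1 - s^2) (b^4 - s^2) and (b^2 - a^2 s^2) (b^2 - s^2 / a^2). The identity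
    also holds at s = 1, where both sides are 0. *)
Lemma quad_subst_integrand e s : e ^+ 2 = 1 -> 0 <= s <= 1 ->
  let k := b * (a ^+ 2 - e) / (a * (b ^+ 2 - e)) in
  let x := quad_subst (b ^+ 2) e s in
  1 / Num.sqrt ((1 - x ^+ 2) * (1 - k ^+ 2 * x ^+ 2)) * quad_subst_deriv (b ^+ 2) e s
  = (b ^+ 2 - e) * ((b ^+ 2 + e * s ^+ 2) / b ^+ 4
      * inv_sqrt_prod (lauricella_args a b) s / Num.sqrt (1 - s ^+ 2)).
Proof.
move=> e2 s01 k x.
have b2 : 1 < b ^+ 2 by rewrite exprn_egt1.
have d0 := quad_subst_den_gt0 b2 e2 s01.
have d0' : b ^+ 2 - e * s ^+ 2 != 0 by rewrite gt_eqF.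
have ce : b ^+ 2 - e != 0.
  have := quad_subst_den_gt0 b2 e2 (_ : 0 <= 1 <= 1).
  by rewrite expr1n mulr1 ler01 lexx => /(_ isT)/gt_eqF ->.
have an : a != 0 by rewrite gt_eqF.
have bn : b != 0 by rewrite gt_eqF.
have sq1 : 0 <= 1 - s ^+ 2.
  by rewrite subr_ge0; case/andP: s01 => s0 s1; rewrite exprn_ile1.
have A0 j : 0 <= 1 - tnth (lauricella_args a b) j * s ^+ 2.
  by have /andP[_ /ltW] := mul_sqr_itv lauricella_args_itv j s01; rewrite subr_ge0.
have := A0 (inord 0); have := A0 (inord 1); have := A0 (inord 2).
rewrite !(tnth_nth 0) !inordK//= => A3 A2 A1.
have -> : (1 - x ^+ 2) * (1 - k ^+ 2 * x ^+ 2) =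
    (1 - s ^+ 2) * ((1 - a ^+ 2 / b ^+ 2 * s ^+ 2) *
      (1 - 1 / (a ^+ 2 * b ^+ 2) * s ^+ 2) * (1 - 1 / b ^+ 4 * s ^+ 2)) *
    (b ^+ 4 / (b ^+ 2 - e * s ^+ 2) ^+ 2) ^+ 2.
  rewrite /x /k /quad_subst; move: ce d0'; move/eqP : e2; rewrite sqrf_eq1.
  by move=> /orP[]/eqP ->; rewrite ?mulNr ?mul1r ?opprK => ce d0'; field;
    rewrite an bn ce d0'.
rewrite sqrtrM; last by rewrite !mulr_ge0.
rewrite sqrtr_sqr ger0_norm ?divr_ge0 ?exprn_ge0 ?(ltW b0) ?(ltW d0)//.
rewrite !sqrtrM ?mulr_ge0// inv_sqrt_prod_lauricella_args /quad_subst_deriv.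
(* The first square root vanishes at s = 1: only the inverses, as opaque
   values, may enter the rational identity. *)
move: (Num.sqrt (1 - s ^+ 2)) (Num.sqrt (1 - a ^+ 2 / b ^+ 2 * s ^+ 2))
  (Num.sqrt (1 - 1 / (a ^+ 2 * b ^+ 2) * s ^+ 2))
  (Num.sqrt (1 - 1 / b ^+ 4 * s ^+ 2)) => r0 r1 r2 r3.
rewrite div1r !(invfM r0, invfM (r1 * r2), invfM r1, invfM (r0 * _)).
move: r0^-1 r1^-1 r2^-1 r3^-1 => {}r0 {}r1 {}r2 {}r3.
by field; rewrite bn d0'.
Qed.

Lemma integrable_lauricella_form e : (@lebesgue_measure R).-integrable `[(0 : R), 1]
  (EFin \o (fun s => (b ^+ 2 + e * s ^+ 2) / b ^+ 4
      * inv_sqrt_prod (lauricella_args a b) s / Num.sqrt (1 - s ^+ 2))).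
Proof.
apply: integrable_div_sqrt1B => s s01.
apply: cvgM; last exact: (continuous_inv_sqrt_prod lauricella_args_itv).
by apply: cvgM; [exact: continuous_addMsqr|exact: cvg_cst].
Qed.

(** The modulus is less than 1 because
    a (b^2 - e) - b (a^2 - e) = (b - a) (a b + e), and a b > 1. *)
Lemma ellipticK_lauricella_form e : e ^+ 2 = 1 ->
  1 / (b ^+ 2 - e) * ellipticK (b * (a ^+ 2 - e) / (a * (b ^+ 2 - e))) =
  \int[@lebesgue_measure R]_(s in `[0, 1])
    ((b ^+ 2 + e * s ^+ 2) / b ^+ 4
      * inv_sqrt_prod (lauricella_args a b) s / Num.sqrt (1 - s ^+ 2)).
Proof.
move=> e2.
have b2 : 1 < b ^+ 2 by rewrite exprn_egt1.
have a2 : 1 < a ^+ 2 by rewrite exprn_egt1.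
have e1 : -1 <= e <= 1 by move/eqP : e2; rewrite sqrf_eq1 => /orP[]/eqP ->; lra.
have ce0 : 0 < b ^+ 2 - e by lra.
have ae0 : 0 < a ^+ 2 - e by lra.
rewrite (ellipticK_quad_subst b2 e2); last first.
  rewrite divr_ge0 ?mulr_ge0 ?ltW//=; first last.
  rewrite ltr_pdivrMr ?mul1r ?mulr_gt0// -subr_gt0.
  have -> : a * (b ^+ 2 - e) - b * (a ^+ 2 - e) = (b - a) * (a * b + e) by ring.
  have ab1 : 1 < a * b by rewrite mulr_egt1.
  by rewrite mulr_gt0 ?subr_gt0//; lra.
rewrite (_ : fine _ = (b ^+ 2 - e) * \int[@lebesgue_measure R]_(s in `[0, 1])
    ((b ^+ 2 + e * s ^+ 2) / b ^+ 4
      * inv_sqrt_prod (lauricella_args a b) s / Num.sqrt (1 - s ^+ 2))).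
  by rewrite div1r mulKf// gt_eqF.
rewrite -RintegralZl//; last exact: integrable_lauricella_form.
congr fine; apply: eq_integral => s; rewrite inE/= in_itv/= => s01.
by rewrite quad_subst_integrand.
Qed.

End lauricella_form.

Theorem theorem4p1 (R : realType) (a b : R) (ha : 1 < a) (hab : a < b) :
  pi = 2 * b ^+ 4
       / lauricellaD (3 / 2) [tuple 1 / 2; 1 / 2; 1 / 2] 2
           [tuple a ^+ 2 / b ^+ 2; 1 / (a ^+ 2 * b ^+ 2); 1 / b ^+ 4]
       * (1 / (b ^+ 2 - 1)
            * ellipticK (b * (a ^+ 2 - 1) / (a * (b ^+ 2 - 1)))
          - 1 / (b ^+ 2 + 1)
            * ellipticK (b * (a ^+ 2 + 1) / (a * (b ^+ 2 + 1)))).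
Proof.
have b0 : 0 < b by rewrite (lt_trans ltr01)// (lt_trans ha).
have b4 : b ^+ 4 != 0 by rewrite expf_neq0// gt_eqF.
have KN : (-1) ^+ 2 = 1 :> R by rewrite sqrrN expr1n.
move/(ellipticK_lauricella_form ha hab) : KN; rewrite !opprK => ->.
rewrite (ellipticK_lauricella_form ha hab (expr1n R 2)).
have [HL L1] := lauricellaD_half_integral (lauricella_args_itv ha hab).
have L0 := lt_le_trans ltr01 L1.
rewrite (_ : [tuple 1 / 2; 1 / 2; 1 / 2] = [tuple 1 / 2 | j < 3]); last first.
  apply: eq_from_tnth => j; rewrite tnth_mktuple (tnth_nth 0).
  by case: j => -[|[|[|]]].
rewrite -/(lauricella_args a b) -RintegralB//; last 2 first.
- exact: (integrable_lauricella_form ha hab).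
- exact: (integrable_lauricella_form ha hab).
rewrite (_ : Rintegral _ _ _ = 2 / b ^+ 4 * (pi / 4 *
    lauricellaD (3 / 2) [tuple 1 / 2 | j < 3] 2 (lauricella_args a b))).
  move: (lauricellaD _ _ _ _) L0 => L L0.
  have Ln : L != 0 by rewrite gt_eqF.
  by move: (b ^+ 4) b4 pi => B B0 p; field; rewrite Ln B0.
transitivity (2 / b ^+ 4 * \int[@lebesgue_measure R]_(s in `[0, 1])
    (s ^+ 2 * inv_sqrt_prod (lauricella_args a b) s / Num.sqrt (1 - s ^+ 2))); last first.
  by rewrite /Rintegral HL.
rewrite -RintegralZl//; last first.
  apply: integrable_div_sqrt1B => s s01.
  apply: cvgM; first exact: exprn_continuous.
  exact: (continuous_inv_sqrt_prod (lauricella_args_itv ha hab)).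
have bn : b != 0 by rewrite gt_eqF.
apply: eq_Rintegral => s _; move: (inv_sqrt_prod _ _) (Num.sqrt _)^-1 => D w.
by field.
Qed.
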